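(* Let $d\in\mathbb{N}$, let $(X,\|\cdot\|)$ be a Banach space and let $F:\mathcal{G}_d\to X$ be almost-additive. If $(G_n)\subseteq\mathcal{G}_d$ is a strongly convergent graph sequence, then there is $\overline{F}\in X$ such that \[ \lim_{n\to\infty}\left\|\frac{F(G_n)}{|V(G_n)|}-\overline{F}\right\|=0. \]
   Context: $\mathcal{G}_d$ is the set of finite simple graphs (no loops, no multiple edges) with all vertex degrees at most $d$, including the empty graph $\epsilon$. For $q\in\mathbb{N}$, $qG$ denotes the disjoint union of $q$ copies of $G$. Distances: if $G,H$ are graphs on the same vertex set $V$ (vertices labeled $1,\dots,|V|$), $\delta(G,H)$ is the proportion of $v\in V$ whose star (the set of neighbours of $v$, with labels) differs in $G$ and $H$; $\delta_S(G,H)=\min_\sigma\delta(G,H^\sigma)$ over all permutations $\sigma$ of $V$, $H^\sigma$ being $H$ with vertices relabeled by $\sigma$ (graphs with equal numbers of vertices are compared by identifying vertex sets via a bijection). For arbitrary $G,H$, $\delta_\rho(G,H)=\inf\{\delta_S(qG,pH): p,q\in\mathbb{N},\ q|V(G)|=p|V(H)|\}$; by convention $\delta=1$ between a graph and the empty graph. Strong convergence: $(G_n)$ is strongly convergent if the sequence of isomorphism classes of the $G_n$ is Cauchy with respect to $\delta_\rho$. Almost-additivity: $F:\mathcal{G}_d\to X$ is almost-additive if $F(\epsilon)=0$ and there is a constant $D>0$ (depending on $d$) such that for all $G,H\in\mathcal{G}_d$ and $p,q\in\mathbb{N}$ with $p|V(G)|=q|V(H)|$, \[ \|pF(G)-qF(H)\|\le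 D\,\delta_S(pG,qH)\,p\,|V(G)|. \] *)

(* Defs.v *)
From HB Require Import structures.
From mathcomp Require Import all_boot all_order all_algebra.
From mathcomp Require Import all_classical all_reals all_analysis.

Set Implicit Arguments.
Unset Strict Implicit.
Unset Printing Implicit Defensive.

Import Order.TTheory GRing.Theory Num.Theory.
Import numFieldNormedType.Exports.

Local Open Scope classical_set_scope.
Local Open Scope ring_scope.

Record sgraph (V : finType) := SGraph {
  adj : rel V;
  adj_sym : symmetric adj;
  adj_irr : irreflexive adj }.

Definition star (V : finType) (G : sgraph V) (v : V) : {set V} :=
  [set w | adj G v w]%SET.

Record bgraph (d : nat) := BGraph {
  vertex : finType;
  graph_of :> sgraph vertex;
  degree_le : forall v : vertex, (#|star graph_of v| <= d)%N }.

Definition nb_vertices (d : nat) (G : bgraph d) : nat := #|vertex G|.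

Section empty_graph.
Variable d : nat.

Let e (x y : void) := false.

Let e_sym : symmetric e. Proof. by []. Qed.

Let e_irr : irreflexive e. Proof. by []. Qed.

Let e_deg (v : void) : (#|star (SGraph e_sym e_irr) v| <= d)%N.
Proof. by case: v. Qed.

Definition empty_graph : bgraph d := BGraph e_deg.

End empty_graph.

Section copies.
Variables (q : nat) (V : finType) (G : sgraph V).

Definition copies_adj : rel ('I_q * V)%type :=
  fun x y => (x.1 == y.1) && adj G x.2 y.2.

Let copies_sym : symmetric copies_adj.
Proof. by move=> x y; rewrite /copies_adj eq_sym adj_sym. Qed.

Let copies_irr : irreflexive copies_adj.
Proof. by move=> x; rewrite /copies_adj adj_irr andbF. Qed.

Definition copies : sgraph ('I_q * V)%type := SGraph copies_sym copies_irr.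

End copies.

(* The graph on V whose vertex v plays the role of the vertex f v of H. *)
Section relabel.
Variables (V W : finType) (f : V -> W) (H : sgraph W).

Definition relabel_adj : rel V := fun x y => adj H (f x) (f y).

Let relabel_sym : symmetric relabel_adj.
Proof. by move=> x y; rewrite /relabel_adj adj_sym. Qed.

Let relabel_irr : irreflexive relabel_adj.
Proof. by move=> x; rewrite /relabel_adj adj_irr. Qed.

Definition relabel : sgraph V := SGraph relabel_sym relabel_irr.

End relabel.

Definition delta (R : realType) (V : finType) (G H : sgraph V) : R :=
  #|[set v | star G v != star H v]%SET|%:R / #|V|%:R.

Definition bijectiveb (V W : finType) (f : {ffun V -> W}) : bool :=
  injectiveb f && [forall w, w \in codom f].

(* The default value 1 does not alter the minimum, since delta <= 1. *)
Definition delta_S (R : realType) (V W : finType)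
    (G : sgraph V) (H : sgraph W) : R :=
  \big[Order.min/1]_(f : {ffun V -> W} | bijectiveb f) delta R G (relabel f H).

(* When exactly one of the graphs is empty, no p, q > 0 are admissible and the
   value is 1 by convention.  When both are empty, the infimum is 0. *)
Definition delta_rho (R : realType) (d : nat) (G H : bgraph d) : R :=
  if (nb_vertices G == 0%N) != (nb_vertices H == 0%N) then 1
  else inf [set r | exists p q : nat,
    [/\ (0 < p)%N, (0 < q)%N, (q * nb_vertices G = p * nb_vertices H)%N
      & r = delta_S R (copies q G) (copies p H)]].

Definition strongly_convergent (R : realType) (d : nat)
    (G : nat -> bgraph d) : Prop :=
  forall e : R, 0 < e -> exists N : nat, forall m n : nat,
    (N <= m)%N -> (N <= n)%N -> delta_rho R (G m) (G n) < e.

Definition almost_additive (R : realType) (d : nat)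
    (X : completeNormedModType R) (F : bgraph d -> X) : Prop :=
  F (empty_graph d) = 0 /\
  exists2 D : R, 0 < D &
    forall (G H : bgraph d) (p q : nat), (0 < p)%N -> (0 < q)%N ->
      (p * nb_vertices G = q * nb_vertices H)%N ->
      `|F G *+ p - F H *+ q|
        <= D * delta_S R (copies p G) (copies q H) * (p * nb_vertices G)%:R.

(* Main.v *)
Require Import Defs.
From HB Require Import structures.
From mathcomp Require Import all_boot all_order all_algebra.
From mathcomp Require Import all_classical all_reals all_analysis.

Import Order.TTheory GRing.Theory Num.Theory.
Import numFieldNormedType.Exports.

Local Open Scope classical_set_scope.
Local Open Scope ring_scope.

(** Dividing the almost-additivity inequality by the common vertex count of $qG$ and $pH$ bounds the
    difference of the densities $F(G)/|V(G)|$ and $F(H)/|V(H)|$ by $D\,\delta_S(qG,pH)$. As $p,q$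
    vary this makes the density $D$-Lipschitz for $\delta_\rho$ at scales up to 1
    ([almost_additive_density_lt]). So a strongly convergent sequence has Cauchy densities, which
    converge since $X$ is complete. *)

Lemma delta_rho_ltP (R : realType) (d : nat) (G H : bgraph d) (e : R) :
  (0 < nb_vertices G)%N -> (0 < nb_vertices H)%N -> delta_rho R G H < e ->
  exists p q : nat,
    [/\ (0 < p)%N, (0 < q)%N, (q * nb_vertices G = p * nb_vertices H)%N
      & delta_S R (copies q G) (copies p H) < e].
Proof.
move=> G0 H0; rewrite /delta_rho !gtn_eqF //= => lt_inf.
set S := [set r | _] in lt_inf.
have S0 : S !=set0.
  (* $|V(H)|$ copies of $G$ and $|V(G)|$ copies of $H$ have equally many vertices, so the infimum is
     over a nonempty set. *)
  exists (delta_S R (copies (nb_vertices H) G) (copies (nb_vertices G) H)).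
  by exists (nb_vertices G), (nb_vertices H); split; rewrite // mulnC.
have [_ [p [q [p0 q0 pq ->]]] lt_e] := inf_lt S0 lt_inf.
by exists p, q.
Qed.

(* For empty graphs the density [F G / |V(G)|] is the junk value [0^-1 *: _ = 0];
   the hypothesis [e <= 1] prevents comparing an empty graph with a nonempty one. *)
Lemma almost_additive_density_lt (R : realType) (d : nat)
    (X : normedModType R) (F : bgraph d -> X) (D : R) :
  0 < D ->
  (forall (G H : bgraph d) (p q : nat), (0 < p)%N -> (0 < q)%N ->
    (p * nb_vertices G = q * nb_vertices H)%N ->
    `|F G *+ p - F H *+ q|
      <= D * delta_S R (copies p G) (copies q H) * (p * nb_vertices G)%:R) ->
  forall (G H : bgraph d) (e : R), 0 < e <= 1 -> delta_rho R G H < e ->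
  `|(nb_vertices G)%:R^-1 *: F G - (nb_vertices H)%:R^-1 *: F H| < D * e.
Proof.
move=> D0 FD G H e /andP[e0 e1] lt_e.
have [G0|G0] := posnP (nb_vertices G); have [H0|H0] := posnP (nb_vertices H).
- by rewrite G0 H0 invr0 !scale0r subrr normr0 mulr_gt0.
- by move: lt_e; rewrite /delta_rho G0 eqxx gtn_eqF //= ltNge e1.
- by move: lt_e; rewrite /delta_rho H0 eqxx gtn_eqF //= ltNge e1.
have [p [q [p0 q0 pq ltS]]] := delta_rho_ltP _ _ _ _ _ G0 H0 lt_e.
have N0 : 0 < (q * nb_vertices G)%:R :> R by rewrite ltr0n muln_gt0 q0.
(* Expanding by [k] puts both densities over the common denominator given by [pq], with numerators
   as in [FD]. *)
have scaleE (K : bgraph d) (k : nat) : (0 < k)%N ->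
    (nb_vertices K)%:R^-1 *: F K = (k * nb_vertices K)%:R^-1 *: (F K *+ k).
  move=> k0; rewrite -(scaler_nat k (F K)) scalerA natrM invfM mulrAC mulVf ?mul1r //.
  by rewrite pnatr_eq0 -lt0n.
rewrite (scaleE G q q0) (scaleE H p p0) -pq -scalerBr normrZ.
rewrite gtr0_norm ?invr_gt0 // mulrC ltr_pdivrMr //.
apply: le_lt_trans (FD _ _ _ _ q0 p0 pq) _.
by rewrite ltr_pM2r // ltr_pM2l.
Qed.

Theorem theorem4p2 (R : realType) (d : nat) (X : completeNormedModType R)
  (F : bgraph d -> X) (G : nat -> bgraph d) :
  almost_additive F -> strongly_convergent R G ->
  exists Fbar : X,
    `|(nb_vertices (G n))%:R^-1 *: F (G n) - Fbar| @[n --> \oo] --> (0 : R).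
Proof.
move=> [_ [D D0 FD]] cvG.
pose u n := (nb_vertices (G n))%:R^-1 *: F (G n).
have u_cauchy : cauchy (u @ \oo).
  apply: cauchy_exP => e e0.
  (* [e / D] absorbs the Lipschitz constant; the cap 1 keeps empty and nonempty graphs apart. *)
  have m0 : 0 < Num.min (e / D) 1 by rewrite lt_min ltr01 divr_gt0.
  have [N hN] := cvG _ m0.
  (* One ball containing a tail suffices, so the index [N] itself provides the centre. *)
  exists (u N), N => // n /= Nn; rewrite -ball_normE /=.
  have m01 : 0 < Num.min (e / D) 1 <= 1 by rewrite m0 ge_min lexx orbT.
  apply: lt_le_trans (almost_additive_density_lt _ _ _ _ _ D0 FD _ _ _ m01
    (hN _ _ (leqnn N) Nn)) _.
  by rewrite mulrC -ler_pdivlMr // ge_min lexx.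
have /cauchy_cvgP/cvg_ex[l ul] := u_cauchy.
exists l.
by apply/norm_cvg0P; rewrite -(subrr l); apply: cvgB ul (cvg_cst l).
Qed.
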